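(* Let $\sigma>0$, $\theta\in[0,2\pi)$, and let $T_{\sigma,\theta}$ be the $3$-Brownian shift on $\mathcal H=H^2(\mathbb D^2)\oplus H^2(\mathbb D)\oplus\mathbb C$. Let $e_3=(0,0,1)^t$. Then $e_3$ is not cyclic for $T_{\sigma,\theta}$, that is, $$\overline{\operatorname{span}}\{T_{\sigma,\theta}^n e_3:\ n\ge0\}\neq\mathcal H.$$
   Context: $H^2(\mathbb D)$ and $H^2(\mathbb D^2)$ are the Hardy spaces of the unit disk and bidisk (power series with square-summable coefficients, $\ell^2$ coefficient norm). The $3$-Brownian shift is $T_{\sigma,\theta}(F,f,\alpha)^t=(z_1F+\sigma f_{z_2},\ zf+\sigma\alpha,\ e^{i\theta}\alpha)^t$, where $f_{z_2}(z_1,z_2):=f(z_2)$. *)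

(* Defs.v *)
From HB Require Import structures.
From mathcomp Require Import all_boot all_order all_algebra.
From mathcomp Require Import all_classical all_reals all_analysis.
From mathcomp Require Import complex ring.

Set Implicit Arguments.
Unset Strict Implicit.
Unset Printing Implicit Defensive.

Import Order.TTheory GRing.Theory Num.Theory.
Import ComplexField.
Import numFieldNormedType.Exports.

Local Open Scope classical_set_scope.
Local Open Scope ring_scope.
Local Open Scope complex_scope.

Section square_summable_families.
Context (R : realType) (I : choiceType).
Implicit Types x y : I -> R[i].

Definition sqsum x : \bar R := \esum_(i in setT) (Normc.normc (x i) ^+ 2)%:E.

Definition square_summable : {pred I -> R[i]} :=
  mem [set x | (sqsum x < +oo)%E].

Lemma square_summableE x : x \in square_summable = (sqsum x < +oo)%E.
Proof. by apply/idP/idP => [/set_mem //|/mem_set]. Qed.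

Lemma sqsum_ge0 x : (0 <= sqsum x)%E.
Proof. by apply: esum_ge0 => i _; rewrite lee_fin sqr_ge0. Qed.

Lemma sqsum_fineK x : x \in square_summable -> (fine (sqsum x))%:E = sqsum x.
Proof.
by rewrite square_summableE => xoo; rewrite fineK// ge0_fin_numE ?sqsum_ge0.
Qed.

Lemma sqsum_le x (M : R) :
  (forall s : seq I, uniq s -> \sum_(i <- s) Normc.normc (x i) ^+ 2 <= M) ->
  (sqsum x <= M%:E)%E.
Proof.
move=> sM; apply: ge_ereal_sup => _ [A [finA _] <-].
by rewrite fsbig_finite//= sumEFin lee_fin sM.
Qed.

Lemma sqsum_ge x (s : seq I) : uniq s ->
  ((\sum_(i <- s) Normc.normc (x i) ^+ 2)%:E <= sqsum x)%E.
Proof.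
move=> us; apply: esum_ge; exists [set` s]; first by split.
by rewrite -fsbig_seq// sumEFin.
Qed.

Lemma sqsum_fin_ge x (s : seq I) : x \in square_summable -> uniq s ->
  \sum_(i <- s) Normc.normc (x i) ^+ 2 <= fine (sqsum x).
Proof. by move=> xP us; rewrite -lee_fin sqsum_fineK// sqsum_ge. Qed.

Lemma square_summable_le x (M : R) : (sqsum x <= M%:E)%E ->
  x \in square_summable.
Proof.
by move=> xM; rewrite square_summableE (le_lt_trans xM)// ltry.
Qed.

Lemma fine_sqsum_le x (M : R) :
  (forall s : seq I, uniq s -> \sum_(i <- s) Normc.normc (x i) ^+ 2 <= M) ->
  fine (sqsum x) <= M.
Proof.
move=> /sqsum_le xM.
by rewrite -lee_fin sqsum_fineK//; apply: square_summable_le xM.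
Qed.

Lemma sqsum0 : sqsum 0 = 0%E.
Proof.
by apply: esum1 => i _; rewrite [X in Normc.normc X](_ : _ = 0)// Normc.normc0 expr0n.
Qed.

Lemma sqsum_eq0 x : x \in square_summable -> fine (sqsum x) = 0 -> x = 0.
Proof.
move=> xP x0; apply/funext => i; apply: Normc.eq0_normc.
have := sqsum_fin_ge (s := [:: i]) xP isT.
rewrite x0 big_seq1 => le0; apply/eqP; rewrite -sqrf_eq0.
by rewrite eq_le le0 sqr_ge0.
Qed.

Lemma sqsumZ_le (a : R[i]) x : x \in square_summable ->
  (sqsum (a *: x) <= (Normc.normc a ^+ 2 * fine (sqsum x))%:E)%E.
Proof.
move=> xP; apply: sqsum_le => s us.
under eq_bigr => i _ do
  rewrite [X in Normc.normc X](_ : _ = a * x i)// Normc.normcM exprMn.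
by rewrite -mulr_sumr ler_wpM2l ?sqr_ge0// sqsum_fin_ge.
Qed.

Lemma sqsum_add_young x y (t : R) : 0 < t ->
  x \in square_summable -> y \in square_summable ->
  (sqsum (x + y)%R <=
    ((1 + t) * fine (sqsum x) + (1 + t^-1) * fine (sqsum y))%:E)%E.
Proof.
move=> t0 xP yP; apply: sqsum_le => s us.
apply: (@le_trans _ _ (\sum_(i <- s) ((1 + t) * Normc.normc (x i) ^+ 2 +
                                   (1 + t^-1) * Normc.normc (y i) ^+ 2))).
  apply: ler_sum => i _; rewrite [X in Normc.normc X](_ : _ = x i + y i)//.
  set a := Normc.normc (x i); set b := Normc.normc (y i).
  apply: (@le_trans _ _ ((a + b) ^+ 2)).
    rewrite lerXn2r ?nnegrE ?le_normcD//.
    - by case: (x i + y i) => u v; rewrite sqrtr_ge0.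
    - by rewrite /a /b addr_ge0//; [case: (x i)|case: (y i)] => u v;
        rewrite sqrtr_ge0.
  rewrite -subr_ge0.
  have -> : (1 + t) * a ^+ 2 + (1 + t^-1) * b ^+ 2 - (a + b) ^+ 2
            = t^-1 * (t * a - b) ^+ 2.
    by field; rewrite gt_eqF.
  by rewrite mulr_ge0 ?sqr_ge0// invr_ge0 ltW.
rewrite big_split /= -!mulr_sumr.
by rewrite lerD// ler_wpM2l ?sqsum_fin_ge// addr_ge0// ?invr_ge0 ltW.
Qed.

Lemma square_summable_submod : submod_closed square_summable.
Proof.
split=> [|a x y xP yP]; first by rewrite square_summableE sqsum0.
have axP : a *: x \in square_summable.
  exact: square_summable_le (sqsumZ_le a xP).
exact: square_summable_le (sqsum_add_young ltr01 axP yP).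
Qed.

HB.instance Definition _ :=
  GRing.isSubmodClosed.Build R[i] (I -> R[i]) square_summable
    square_summable_submod.

Record l2 := L2 { l2_coef :> I -> R[i] ; l2_coefP : l2_coef \in square_summable }.

HB.instance Definition _ := [isSub for l2_coef].
HB.instance Definition _ := [Choice of l2 by <:].
HB.instance Definition _ := [SubChoice_isSubLmodule of l2 by <:].

Definition l2norm (x : l2) : R := Num.sqrt (fine (sqsum x)).

Lemma fine_sqsum_ge0 x : 0 <= fine (sqsum x).
Proof. exact/fine_ge0/sqsum_ge0. Qed.

Lemma l2norm_sqr (x : l2) : l2norm x ^+ 2 = fine (sqsum x).
Proof. by rewrite sqr_sqrtr// fine_sqsum_ge0. Qed.

Lemma l2norm_ge0 (x : l2) : 0 <= l2norm x.
Proof. exact: sqrtr_ge0. Qed.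

Lemma l2norm_eq0 (x : l2) : l2norm x = 0 -> x = 0.
Proof.
move=> x0; apply/val_inj/sqsum_eq0; first exact: l2_coefP.
by rewrite -l2norm_sqr x0 expr0n.
Qed.

Lemma ler_l2normD (x y : l2) : l2norm (x + y) <= l2norm x + l2norm y.
Proof.
have [/l2norm_eq0 ->|x0] := eqVneq (l2norm x) 0.
  by rewrite add0r lerDr l2norm_ge0.
have [/l2norm_eq0 ->|y0] := eqVneq (l2norm y) 0.
  by rewrite addr0 lerDl l2norm_ge0.
have {}x0 : 0 < l2norm x by rewrite lt_neqAle eq_sym x0 l2norm_ge0.
have {}y0 : 0 < l2norm y by rewrite lt_neqAle eq_sym y0 l2norm_ge0.
rewrite -(@ler_pXn2r _ 2)// ?nnegrE ?addr_ge0 ?l2norm_ge0//.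
have t0 : 0 < l2norm y / l2norm x by rewrite divr_gt0.
have := sqsum_add_young t0 (l2_coefP x) (l2_coefP y).
rewrite -(sqsum_fineK (l2_coefP (x + y))) lee_fin -!l2norm_sqr.
move=> /le_trans; apply; rewrite le_eqVlt; apply/orP; left; apply/eqP.
by field; rewrite !gt_eqF.
Qed.

Lemma ler_l2normZ (a : R[i]) (x : l2) :
  l2norm (a *: x) <= Normc.normc a * l2norm x.
Proof.
have a0 : 0 <= Normc.normc a by case: a => u v; rewrite sqrtr_ge0.
rewrite -(@ler_pXn2r _ 2)// ?nnegrE ?mulr_ge0 ?l2norm_ge0//.
rewrite exprMn !l2norm_sqr -lee_fin.
by rewrite (sqsum_fineK (l2_coefP (a *: x))) sqsumZ_le// l2_coefP.
Qed.

Lemma l2normZ (a : R[i]) (x : l2) :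
  l2norm (a *: x) = Normc.normc a * l2norm x.
Proof.
apply/le_anti; rewrite ler_l2normZ/=.
have [->|a0] := eqVneq a 0; first by rewrite Normc.normc0 mul0r l2norm_ge0.
have na0 : 0 < Normc.normc a.
  rewrite lt_neqAle; apply/andP; split; last by case: (a) => u v; rewrite sqrtr_ge0.
  by rewrite eq_sym; apply: contra_neq a0 => /Normc.eq0_normc.
have := ler_l2normZ a^-1 (a *: x); rewrite scalerA mulVf// scale1r Normc.normcV.
by rewrite ler_pdivlMl.
Qed.

Let normC (x : l2) : R[i] := (l2norm x)%:C.

Let ler_normCD (x y : l2) : normC (x + y) <= normC x + normC y.
Proof. by rewrite /normC -rmorphD lecR ler_l2normD. Qed.

Let normCZ (a : R[i]) (x : l2) : normC (a *: x) = `|a| * normC x.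
Proof. by rewrite /normC l2normZ rmorphM; case: a. Qed.

Let normC_eq0 (x : l2) : normC x = 0 -> x = 0.
Proof. by move=> /complexI /l2norm_eq0. Qed.

HB.instance Definition _ :=
  Lmodule_isNormed.Build R[i] l2 ler_normCD normCZ normC_eq0.

Lemma l2_normE (x : l2) : `|x| = (l2norm x)%:C.
Proof. by []. Qed.

End square_summable_families.
Arguments l2 : clear implicits.
Arguments square_summable {R I}.

Lemma square_summable_pullback (R : realType) (I J : choiceType)
    (x : I -> R[i]) (p : J -> option I) (g : I -> J) :
  ocancel p g -> x \in square_summable ->
  (fun j => oapp x 0 (p j)) \in square_summable.
Proof.
move=> pK xP; apply: (@square_summable_le _ _ _ (fine (sqsum x))).
apply: sqsum_le => s us.
apply: le_trans (sqsum_fin_ge xP (pmap_uniq pK us)).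
rewrite le_eqVlt; apply/orP; left; apply/eqP.
elim: s {us} => [|j s IH]; first by rewrite !big_nil.
rewrite big_cons IH [pmap p (j :: s)]/=; case: (p j) => [i|].
  by rewrite big_cons.
by rewrite [oapp _ _ _]/= Normc.normc0 expr0n add0r.
Qed.

(* An element of a Hardy space is its family of Taylor coefficients:
   f = \sum_n f n z^n and F = \sum_(m, n) F (m, n) z1^m z2^n. *)
Definition hardy_disk (R : realType) := l2 R nat.
Definition hardy_bidisk (R : realType) := l2 R (nat * nat)%type.

Section brownian_shift.
Context (R : realType).

(* z |-> z * f z *)
Definition mulz_coef (f : nat -> R[i]) (n : nat) : R[i] :=
  if n is n'.+1 then f n' else 0.

Lemma mulz_subproof (f : hardy_disk R) :
  mulz_coef f \in square_summable.
Proof.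
pose p (n : nat) := if n is n'.+1 then Some n' else None.
rewrite (_ : mulz_coef f = fun n => oapp f 0 (p n)); last first.
  by apply/funext => -[].
by apply: (@square_summable_pullback _ _ _ _ p succn); [case|exact: l2_coefP].
Qed.

Definition mulz (f : hardy_disk R) : hardy_disk R := L2 (mulz_subproof f).

(* (z1, z2) |-> z1 * F (z1, z2) *)
Definition mulz1_coef (F : nat * nat -> R[i]) (k : nat * nat) : R[i] :=
  if k is (m.+1, n) then F (m, n) else 0.

Lemma mulz1_subproof (F : hardy_bidisk R) :
  mulz1_coef F \in square_summable.
Proof.
pose p (k : nat * nat) := if k is (m.+1, n) then Some (m, n) else None.
rewrite (_ : mulz1_coef F = fun k => oapp F 0 (p k)); last first.
  by apply/funext => -[[]].
apply: (@square_summable_pullback _ _ _ _ p (fun k => (k.1.+1, k.2))).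
  by case=> -[].
exact: l2_coefP.
Qed.

Definition mulz1 (F : hardy_bidisk R) : hardy_bidisk R :=
  L2 (mulz1_subproof F).

(* the function (z1, z2) |-> f z2 *)
Definition in_z2_coef (f : nat -> R[i]) (k : nat * nat) : R[i] :=
  if k is (0%N, n) then f n else 0.

Lemma in_z2_subproof (f : hardy_disk R) :
  in_z2_coef f \in square_summable.
Proof.
pose p (k : nat * nat) := if k is (0%N, n) then Some n else None.
rewrite (_ : in_z2_coef f = fun k => oapp f 0 (p k)); last first.
  by apply/funext => -[[]].
apply: (@square_summable_pullback _ _ _ _ p (fun n => (0%N, n))).
  by case=> -[].
exact: l2_coefP.
Qed.

Definition in_z2 (f : hardy_disk R) : hardy_bidisk R :=
  L2 (in_z2_subproof f).

(* the constant function a *)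
Definition constz_coef (a : R[i]) (n : nat) : R[i] :=
  if n is 0%N then a else 0.

Lemma constz_subproof (a : R[i]) : constz_coef a \in square_summable.
Proof.
pose p (n : nat) := if n is 0%N then Some tt else None.
rewrite (_ : constz_coef a = fun n => oapp (fun=> a) 0 (p n)); last first.
  by apply/funext => -[].
apply: (@square_summable_pullback _ _ _ _ p (fun=> 0%N)); first by case.
apply: (@square_summable_le _ _ _ (Normc.normc a ^+ 2)).
apply: sqsum_le => -[|[] [|[] s]]//= _; rewrite ?big_nil ?sqr_ge0//.
by rewrite big_seq1.
Qed.

Definition constz (a : R[i]) : hardy_disk R := L2 (constz_subproof a).

(* The product carries the max norm, which induces the same topology as the
   Hilbert direct sum norm. *)
Definition brownian_space : normedModType R[i] :=
  (hardy_bidisk R * hardy_disk R * (R[i])^o)%type.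

Definition expi (theta : R) : R[i] := cos theta +i* sin theta.

Definition brownian_shift (sigma theta : R) (h : brownian_space) :
    brownian_space :=
  let: (F, f, alpha) := h in
  (mulz1 F + sigma%:C *: in_z2 f,
   mulz f + constz (sigma%:C * alpha),
   expi theta * alpha).

Definition e3 : brownian_space := (0, 0, 1).

End brownian_shift.
Arguments e3 : clear implicits.
Arguments brownian_space : clear implicits.

Definition lin_span (K : numFieldType) (V : lmodType K) (A : set V) : set V :=
  [set x | exists (n : nat) (a : 'I_n -> K) (v : 'I_n -> V),
    (forall i, A (v i)) /\ x = \sum_(i < n) a i *: v i].

Definition cyclic_vector (K : numFieldType) (V : normedModType K) (T : V -> V)
    (x : V) : Prop :=
  closure (lin_span (range (fun n => iter n T x))) = [set: V].

(* Main.v *)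
Require Import Defs.
From HB Require Import structures.
From mathcomp Require Import all_boot all_order all_algebra.
From mathcomp Require Import all_classical all_reals all_analysis.
From mathcomp Require Import complex.

Import Order.TTheory GRing.Theory Num.Theory.
Import numFieldNormedType.Exports.

Local Open Scope classical_set_scope.
Local Open Scope ring_scope.

(** The range of the shift [T] lies in a closed hyperplane that also contains
    [e3].  The shift puts [sigma * f 0] into the [(0, 0)]
    coefficient of the bidisk component and moves [f 0] to the coefficient of
    [z] in the disk component, so every vector [(F, f, alpha)]
    in the range of [T] satisfies [F (0, 0) = sigma * f 1].  The vector [e3]
    satisfies the same relation because its first two components vanish.
    Hence the whole orbit of [e3] lies in the kernel of the linear functional
    [F (0, 0) - sigma * f 1] ([shift_defect]).  This functional is continuous,
    because a coefficient is bounded by the norm ([normc_coef_le]), and it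
    takes the value 1 at the constant function 1 of the bidisk, so the closed
    span of the orbit lies in a proper closed hyperplane. *)

Lemma normc_coef_le (R : realType) (I : choiceType) (x : l2 R I) (i : I) :
  Normc.normc (x i) <= l2norm x.
Proof.
rewrite -(@ler_pXn2r _ 2)// ?nnegrE ?l2norm_ge0//; last first.
  by case: (x i) => u v; rewrite sqrtr_ge0.
have := @sqsum_fin_ge _ _ _ [:: i] (l2_coefP x) isT.
by rewrite big_seq1 l2norm_sqr.
Qed.

Lemma continuous_coef (R : realType) (I : choiceType) (i : I) :
  continuous (fun x : l2 R I => x i : R[i]^o).
Proof.
move=> x; apply/(@cvgrPdist_lt _ _ _ (nbhs x) (nbhs_filter x)) => e e0.
apply/nbhs_normP; exists e => // y /= xy; apply: le_lt_trans xy.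
have -> : x i - y i = (x - y) i by [].
have -> : `|(x - y) i : R[i]^o| = (Normc.normc ((x - y) i))%:C%C.
  by case: ((x - y) i).
by rewrite l2_normE lecR normc_coef_le.
Qed.

Definition shift_defect {R : realType} (sigma : R) (h : brownian_space R) :
  R[i]^o := h.1.1 (0%N, 0%N) - sigma%:C%C *: (h.1.2 1%N : R[i]^o).

Lemma shift_defect_is_linear (R : realType) (sigma : R) :
  linear (@shift_defect R sigma).
Proof.
move=> a [[F f] u] [[G g] v]; rewrite /shift_defect /=.
change (a * F (0%N, 0%N) + G (0%N, 0%N) - sigma%:C%C * (a * f 1%N + g 1%N) =
  a * (F (0%N, 0%N) - sigma%:C%C * f 1%N) +
  (G (0%N, 0%N) - sigma%:C%C * g 1%N)).
by rewrite mulrDr mulrBr opprD addrACA mulrCA.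
Qed.

HB.instance Definition _ (R : realType) (sigma : R) :=
  GRing.isLinear.Build R[i] (brownian_space R) R[i]^o _ (@shift_defect R sigma)
    (@shift_defect_is_linear R sigma).

Lemma continuous_shift_defect (R : realType) (sigma : R) :
  continuous (@shift_defect R sigma).
Proof.
move=> h; apply: cvgB; last apply: cvgZl_tmp.
  apply: (@continuous_comp _ _ _ (fun h : brownian_space R => h.1.1)
    (fun F : hardy_bidisk R => F (0%N, 0%N) : R[i]^o)); last exact: continuous_coef.
  by apply: continuous_comp; [exact: cvg_fst|exact: cvg_fst].
apply: (@continuous_comp _ _ _ (fun h : brownian_space R => h.1.2)
  (fun f : hardy_disk R => f 1%N : R[i]^o)); last exact: continuous_coef.
by apply: continuous_comp; [exact: cvg_fst|exact: cvg_snd].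
Qed.

Lemma shift_defect_range (R : realType) (sigma theta : R)
    (h : brownian_space R) :
  shift_defect sigma (brownian_shift sigma theta h) = 0.
Proof.
case: h => [[F f] u].
change (0 + sigma%:C%C * f 0%N - sigma%:C%C * (f 0%N + 0) = 0).
by rewrite add0r addr0 subrr.
Qed.

Lemma shift_defect_e3 (R : realType) (sigma : R) :
  shift_defect sigma (e3 R) = 0.
Proof. by change (0 - sigma%:C%C * 0 = 0); rewrite mulr0 subrr. Qed.

Lemma shift_defect_const1 (R : realType) (sigma : R) :
  shift_defect sigma (in_z2 (constz 1), 0, 0) = 1.
Proof. by change (1 - sigma%:C%C * 0 = 1); rewrite mulr0 subr0. Qed.

(** The kernel of a continuous linear functional is a closed subspace, so it
    absorbs linear combinations and limits. *)
Lemma closed_span_sub_kernel (K : numFieldType) (V : normedModType K)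
    (phi : {linear V -> K^o}) (A : set V) :
  continuous phi -> (forall x, A x -> phi x = 0) ->
  closure (lin_span A) `<=` phi @^-1` [set 0].
Proof.
move=> phic phiA; rewrite (closure_id (phi @^-1` [set 0])).1; last first.
  apply: preimage_closed => [x _|]; first exact: phic.
  exact/accessible_closed_set1/hausdorff_accessible/norm_hausdorff.
apply: closure_subset => _ [n [a [v [Av ->]]]] /=.
by rewrite linear_sum big1// => i _; rewrite linearZ /= phiA// scaler0.
Qed.

Theorem proposition2p3 (R : realType) (sigma theta : R)
  (hsigma : 0 < sigma) (htheta : 0 <= theta < 2 * pi) :
  ~ cyclic_vector (@brownian_shift R sigma theta) (e3 R).
Proof.
move=> cyc.
have orbit0 x : range (fun n => iter n (brownian_shift sigma theta) (e3 R)) x ->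
    shift_defect sigma x = 0.
  by case=> -[|n] _ <-; [exact: shift_defect_e3|exact: shift_defect_range].
have := @closed_span_sub_kernel _ _ (@shift_defect R sigma) _
  (@continuous_shift_defect R sigma) orbit0 (in_z2 (constz 1), 0, 0).
rewrite [closure _]cyc => /(_ I) /=; rewrite shift_defect_const1.
by apply/eqP; rewrite oner_eq0.
Qed.
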